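(* Let $\varphi$ be a $\mathrm{TeamLTL}^s(\sim)$-formula. Then $T\models\varphi\Leftrightarrow\mathcal{M}_T\models_{S^x_T} ST^*_x(\varphi)$ for all non-empty $T$, and there exists an $\mathrm{FO}^3(=\!(\ldots),\sim)$-sentence $\psi$ such that for all non-empty $T$ $$T\models\varphi\Leftrightarrow\mathcal{M}_T\models \psi.$$
   Context: $\mathrm{TeamLTL}^s(\sim)$ is LTL under synchronous team semantics (a team is a set $T$ of traces; $T\models\varphi U\psi$ iff there is $k\ge0$ with $T[k,\infty)\models\psi$ and $T[k',\infty)\models\varphi$ for all $k'<k$; splitjunction $\vee$ splits the team) extended with Boolean negation $\sim$. $T$ is encoded by the structure $\mathcal{M}_T$ with domain $T\times\mathbb{N}$, $(t_i,n)\le(t_j,m)$ iff $i=j$ and $n\le m$, predicates $P_i=\{(t,j)\mid p_i\in t(j)\}$, and the equal-level predicate $E=\{((t,n),(t',m))\mid n=m\}$. $S^x_T=\{s\mid s(x)=(t,0),t\in T\}$. $\mathrm{FO}^3(=\!(\ldots),\sim)$ is three-variable first-order team logic with dependence atoms $=\!(x_1,\dots,x_n,y)$ (any two assignments agreeing on the $x_i$ agree on $y$; $=\!(y)$ says $y$ is constant in the team) and Boolean negation $\sim$. The translation $ST^*_x$ is: $ST^*_x(p_i)=P_i(x)$, $ST^*_x(\neg p_i)=\neg P_i(x)$, commuting with $\wedge,\vee,\sim$, $ST^*_x(X\varphi)=\exists y(S(x,y)\wedge ST^*_y(\varphi))$ where $S(x,y)$ defines $y$ as the successor of $x$ on the same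 trace, and $ST^*_x(\varphi U\psi)=\exists z\exists y(=\!(z)\wedge x\le y\wedge E(z,y)\wedge ST^*_y(\psi))\wedge\sim\exists z(\exists x(=\!(x)\wedge E(z,x))\wedge x\le z<y\wedge\sim ST^*_z(\varphi))$.
   Formalization: In the U clause, z<y is read as z≤y ∧ ∼(z=y) with Boolean negation, as pointwise strictness makes the claim fail on empty subteams arising from splits; and ∃z∃y there bind both conjuncts, as y would otherwise be free. *)

(* Defs.v *)
From mathcomp Require Import all_boot.
From mathcomp Require Import boolp classical_sets.
Set Implicit Arguments.
Unset Strict Implicit.
Unset Printing Implicit Defensive.
Local Open Scope classical_set_scope.

(** * LTL with Boolean negation under synchronous team semantics *)

Definition trace (AP : Type) := nat -> set AP.

Definition suffix_trace (AP : Type) (k : nat) (t : trace AP) : trace AP :=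
  fun j => t (k + j)%N.

Definition suffix_team (AP : Type) (k : nat) (T : set (trace AP)) :
  set (trace AP) := suffix_trace k @` T.

Inductive ltl (AP : Type) : Type :=
| LProp of AP
| LNProp of AP
| LAnd of ltl AP & ltl AP
| LOr of ltl AP & ltl AP
| LBNeg of ltl AP
| LNext of ltl AP
| LUntil of ltl AP & ltl AP.

Fixpoint team_sat (AP : Type) (T : set (trace AP)) (phi : ltl AP) : Prop :=
  match phi with
  | LProp p => forall t, T t -> t 0%N p
  | LNProp p => forall t, T t -> ~ t 0%N p
  | LAnd a b => team_sat T a /\ team_sat T b
  | LOr a b =>
      exists T1 T2, [/\ T = T1 `|` T2, team_sat T1 a & team_sat T2 b]
  | LBNeg a => ~ team_sat T a
  | LNext a => team_sat (suffix_team 1 T) a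
  | LUntil a b => exists k : nat, team_sat (suffix_team k T) b /\
      forall k' : nat, (k' < k)%N -> team_sat (suffix_team k' T) a
  end.

(** * First-order team logic with dependence atoms and Boolean negation *)

Record structure (AP : Type) : Type := Structure {
  dom : Type;
  le_rel : dom -> dom -> Prop;
  lvl_rel : dom -> dom -> Prop;
  pred_rel : AP -> dom -> Prop }.

Inductive atom (V : eqType) (AP : Type) : Type :=
| APred of AP & V
| AEq of V & V
| ALe of V & V
| ALvl of V & V.
Arguments AEq {V AP}.
Arguments ALe {V AP}.
Arguments ALvl {V AP}.

(* [FNeg] is the first-order negation, allowed in front of atoms only;
   [FBNeg] is the Boolean negation. *)
Inductive fo (V : eqType) (AP : Type) : Type :=
| FPos of atom V AP
| FNeg of atom V AP
| FDep of seq V & V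
| FAnd of fo V AP & fo V AP
| FOr of fo V AP & fo V AP
| FBNeg of fo V AP
| FEx of V & fo V AP
| FAll of V & fo V AP.
Arguments FDep {V AP}.

Definition atom_vars (V : eqType) (AP : Type) (a : atom V AP) : seq V :=
  match a with
  | APred _ x => [:: x]
  | AEq x y | ALe x y | ALvl x y => [:: x; y]
  end.

Fixpoint free_vars (V : eqType) (AP : Type) (f : fo V AP) : seq V :=
  match f with
  | FPos a | FNeg a => atom_vars a
  | FDep xs y => rcons xs y
  | FAnd f g | FOr f g => free_vars f ++ free_vars g
  | FBNeg f => free_vars f
  | FEx x f | FAll x f => [seq v <- free_vars f | v != x]
  end.

Definition sentence (V : eqType) (AP : Type) (f : fo V AP) : Prop :=
  free_vars f = [::].

(* Assignments are partial: [s x = None] means that [x] is not in the domain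
   of [s]. *)
Definition assignment (V : eqType) (D : Type) := V -> option D.

Definition no_assignment (V : eqType) (D : Type) : assignment V D :=
  fun=> None.

Definition update (V : eqType) (D : Type) (s : assignment V D) (x : V) (a : D) :
  assignment V D := fun v => if v == x then Some a else s v.

Definition atom_sat (V : eqType) (AP : Type) (M : structure AP)
    (s : assignment V (dom M)) (a : atom V AP) : Prop :=
  match a with
  | APred p x => exists2 d, s x = Some d & pred_rel p d
  | AEq x y => exists d e, [/\ s x = Some d, s y = Some e & d = e]
  | ALe x y => exists d e, [/\ s x = Some d, s y = Some e & le_rel d e]
  | ALvl x y => exists d e, [/\ s x = Some d, s y = Some e & lvl_rel d e]
  end.

Definition supplement (V : eqType) (D : Type) (S : set (assignment V D))
    (x : V) (F : assignment V D -> set D) : set (assignment V D) :=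
  [set s' | exists s a, [/\ S s, F s a & s' = update s x a]].

(* Lax semantics: the supplementing function of an existential quantifier is
   set-valued and a splitting of a team need not be disjoint. *)
Fixpoint fo_sat (V : eqType) (AP : Type) (M : structure AP)
    (S : set (assignment V (dom M))) (f : fo V AP) : Prop :=
  match f with
  | FPos a => forall s, S s -> atom_sat s a
  | FNeg a => forall s, S s -> ~ atom_sat s a
  | FDep xs y => forall s s', S s -> S s' ->
      (forall x, x \in xs -> s x = s' x) -> s y = s' y
  | FAnd f g => fo_sat S f /\ fo_sat S g
  | FOr f g => exists S1 S2, [/\ S = S1 `|` S2, fo_sat S1 f & fo_sat S2 g]
  | FBNeg f => ~ fo_sat S f
  | FEx x f => exists F : assignment V (dom M) -> set (dom M),
      (forall s, S s -> F s !=set0) /\ fo_sat (supplement S x F) f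
  | FAll x f => fo_sat (supplement S x (fun=> setT)) f
  end.

Definition fo_true (V : eqType) (AP : Type) (M : structure AP) (f : fo V AP) :
  Prop := fo_sat [set @no_assignment V (dom M)] f.

Definition fo3 (AP : Type) := fo 'I_3 AP.

Definition vx : 'I_3 := @Ordinal 3 0 isT.
Definition vy : 'I_3 := @Ordinal 3 1 isT.
Definition vz : 'I_3 := @Ordinal 3 2 isT.

(** * Encoding a team of traces *)

Definition team_structure (AP : Type) (T : set (trace AP)) : structure AP :=
  @Structure AP ({t : trace AP | T t} * nat)%type
    (fun a b => a.1 = b.1 /\ (a.2 <= b.2)%N)
    (fun a b => a.2 = b.2)
    (fun p a => sval a.1 a.2 p).

Definition init_team (AP : Type) (T : set (trace AP)) (V : eqType) (x : V) :
  set (assignment V (dom (team_structure T))) :=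
  [set s | exists t : {t : trace AP | T t},
     s = update (@no_assignment V (dom (team_structure T))) x (t, 0%N)].
Arguments init_team {AP} T {V} x.

(** * The translation *)

(* [y] is the successor of [x] on the same trace; [z] is an auxiliary bound
   variable. *)
Definition succ_fo (V : eqType) (AP : Type) (x y z : V) : fo V AP :=
  FAnd (FPos (ALe x y)) (FAnd (FNeg (AEq x y))
    (FAll z (FOr (FNeg (ALe x z)) (FOr (FPos (AEq z x)) (FPos (ALe y z)))))).

(* Strictness is expressed with the Boolean negation.  Where the translation
   uses it, [z] lies on the trace of [y] and both variables have a constant
   level, so on non-empty teams it means pointwise strictness; on the empty
   team it fails.  The latter is needed: the empty team satisfies a formula
   [LUntil a b] as soon as it satisfies [b], since one may take k = 0, while
   with a pointwise [z < y], true in the empty team, the translation would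
   also require [a] there, and empty subteams do occur in splittings. *)
Definition lt_fo (V : eqType) (AP : Type) (z y : V) : fo V AP :=
  FAnd (FPos (ALe z y)) (FBNeg (FPos (AEq z y))).

(* [ST x y z phi] has [x] as its only free variable; the translations for the
   other two variables are obtained by interchanging variables.  In the clause
   for [LUntil] the quantifiers over [z] and [y] bind both conjuncts, as [y]
   occurs in the second one. *)
Fixpoint ST (V : eqType) (AP : Type) (x y z : V) (phi : ltl AP) : fo V AP :=
  match phi with
  | LProp p => FPos (APred p x)
  | LNProp p => FNeg (APred p x)
  | LAnd a b => FAnd (ST x y z a) (ST x y z b)
  | LOr a b => FOr (ST x y z a) (ST x y z b)
  | LBNeg a => FBNeg (ST x y z a)
  | LNext a => FEx y (FAnd (succ_fo AP x y z) (ST y x z a))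
  | LUntil a b =>
      FEx z (FEx y (FAnd
        (FAnd (FDep [::] z) (FAnd (FPos (ALe x y))
          (FAnd (FPos (ALvl z y)) (ST y x z b))))
        (FBNeg (FEx z
          (FAnd (FEx x (FAnd (FDep [::] x) (FPos (ALvl z x))))
            (FAnd (FAnd (FPos (ALe x z)) (lt_fo AP z y))
              (FBNeg (ST z y x a))))))))
  end.

(* Main.v *)
Require Import Defs.
From mathcomp Require Import all_boot.
From mathcomp Require Import boolp classical_sets.
Set Implicit Arguments.
Unset Strict Implicit.
Unset Printing Implicit Defensive.
Local Open Scope classical_set_scope.

(** Along the translation the free variable has the same level n in all
    assignments, so an assignment team carries exactly the trace team of the
    suffixes from n, and [ST] is correct for every such team, whatever the
    other variables are.  In the clause for U, the dependence atom makes the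
    level of z constant, hence also that of y.  For the sentence, quantify x
    universally and split: the disjunct "x is not first" can only take the
    non-initial positions, and "x is first" only the initial ones, so the
    other disjunct is evaluated exactly on the initial team. *)

(** * Assignment teams at a constant level: the trace teams they carry, supplements, successors and
    splittings *)

Notation fo_team T V := (set (assignment V (dom (team_structure T)))).

Definition at_level {AP : Type} {T : set (trace AP)} {V : eqType}
    (S : fo_team T V) (x : V) (n : nat) : Prop :=
  forall s, S s -> exists t, s x = Some (t, n).

Definition aligned {AP : Type} {T : set (trace AP)} {V : eqType}
    (S : fo_team T V) (x y : V) (n m : nat) : Prop :=
  forall s, S s -> exists t, s x = Some (t, n) /\ s y = Some (t, m).

Definition tail_team {AP : Type} {T : set (trace AP)} {V : eqType}
    (S : fo_team T V) (x : V) : set (trace AP) :=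
  [set u | exists s d,
     [/\ S s, s x = Some d & u = suffix_trace d.2 (sval d.1)]].

Lemma update_eq (V : eqType) (D : Type) (s : assignment V D) (x : V) (a : D) :
  update s x a x = Some a.
Proof. by rewrite /update eqxx. Qed.

Lemma update_neq (V : eqType) (D : Type) (s : assignment V D) (x v : V) (a : D) :
  v != x -> update s x a v = s v.
Proof. by rewrite /update => /negbTE ->. Qed.

Lemma suffix_traceD (AP : Type) (n k : nat) (t : trace AP) :
  suffix_trace k (suffix_trace n t) = suffix_trace (n + k) t.
Proof. by apply/funext => j; rewrite /suffix_trace addnA. Qed.

(** Turns a change of the free variable into the temporal step of X or U: cutting off [n] and then
    [k] positions of a trace cuts off [n + k]. *)
Lemma aligned_tail_team (AP : Type) (T : set (trace AP)) (V : eqType)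
    (S : fo_team T V) (x y : V) (n k : nat) :
  aligned S x y n (n + k) ->
  tail_team S y = suffix_team k (tail_team S x).
Proof.
move=> al; apply/seteqP; split=> u /=.
  move=> [s [d [Ss sy ->]]]; have [t [sx sy']] := al s Ss.
  move: sy; rewrite sy' => -[<-] /=.
  exists (suffix_trace n (sval t)); last by rewrite suffix_traceD.
  by exists s, (t, n).
move=> [_ [s [d [Ss sx ->]]] <-]; have [t [sx' sy]] := al s Ss.
move: sx; rewrite sx' => -[<-] /=.
by exists s, (t, (n + k)%N); rewrite suffix_traceD.
Qed.

(** Since no value of [F] is empty, no assignment is lost in the supplement, and rebinding [y]
    leaves the value of [x] alone. *)
Lemma tail_team_supplement (AP : Type) (T : set (trace AP)) (V : eqType)
    (S : fo_team T V) (x y : V)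
    (F : assignment V (dom (team_structure T)) -> set (dom (team_structure T))) :
  x != y -> (forall s, S s -> F s !=set0) ->
  tail_team (supplement S y F) x = tail_team S x.
Proof.
move=> xy F0; apply/seteqP; split=> u /=.
  move=> [_ [d [[s [a [Ss _ ->]]]]]]; rewrite update_neq// => sx ->.
  by exists s, d.
move=> [s [d [Ss sx ->]]]; have [a Fa] := F0 s Ss.
by exists (update s y a), d; split; [exists s, a|rewrite update_neq|].
Qed.

Lemma at_level_supplement (AP : Type) (T : set (trace AP)) (V : eqType)
    (S : fo_team T V) (x y : V) (n : nat)
    (F : assignment V (dom (team_structure T)) -> set (dom (team_structure T))) :
  x != y -> at_level S x n -> at_level (supplement S y F) x n.
Proof.
by move=> xy lS _ [s [a [Ss _ ->]]]; rewrite update_neq//; exact: lS.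
Qed.

Lemma aligned_levelr (AP : Type) (T : set (trace AP)) (V : eqType)
    (S : fo_team T V) (x y : V) (n m : nat) :
  aligned S x y n m -> at_level S y m.
Proof. by move=> al s /al[t [_ ?]]; exists t. Qed.

(** Serves as choice function for quantifiers whose new variable must lie on the trace of [x]. It
    has at most one value, so the new variable gets a single level over the whole team. *)
Definition jump {AP : Type} {T : set (trace AP)} {V : eqType} (x : V) (m : nat) :
    assignment V (dom (team_structure T)) -> set (dom (team_structure T)) :=
  fun s => [set d | exists t n, s x = Some (t, n) /\ d = (t, m)].

Lemma jump_neq0 (AP : Type) (T : set (trace AP)) (V : eqType)
    (S : fo_team T V) (x : V) (n m : nat) :
  at_level S x n -> forall s, S s -> jump x m s !=set0.
Proof. by move=> lS s /lS[t sx]; exists (t, m), t, n. Qed.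

Lemma aligned_jump (AP : Type) (T : set (trace AP)) (V : eqType)
    (S : fo_team T V) (x y : V) (n m : nat) :
  x != y -> at_level S x n -> aligned (supplement S y (jump x m)) x y n m.
Proof.
move=> xy lS _ [s [d [Ss + ->]]]; have [t sx] := lS s Ss.
move=> [t' [n' [+ ->]]]; rewrite sx => -[<- _].
by exists t; rewrite update_neq// update_eq.
Qed.

(** [succ_fo] is built from literals by conjunction, disjunction and universal quantification only,
    so it holds in a team once it holds at each assignment: disjunctions are split by the truth of
    their atoms. *)
Lemma succ_fo_aligned (AP : Type) (T : set (trace AP)) (V : eqType)
    (S : fo_team T V) (x y z : V) (n : nat) :
  x != z -> y != z -> at_level S x n ->
  fo_sat (M := team_structure T) S (succ_fo AP x y z) <-> aligned S x y n n.+1.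
Proof.
move=> xz yz lS; split=> [[le [ne [S1 [S0 [eS nle [S2 [S3 [eS0 eq le']]]]]]]] | al].
  move=> s Ss; have [t sx] := lS s Ss.
  have [d [[t' m] [/=]]] := le s Ss.
  rewrite sx => -[<-] sy [/= ? nm]; subst t'.
  exists t; split=> //; rewrite sy; congr (Some (_, _)).
  have {}nm : (n < m)%N.
    rewrite ltn_neqAle nm andbT; apply/negP => /eqP ?; subst m.
    by apply: (ne s Ss) => /=; exists (t, n), (t, n).
  apply/eqP; rewrite eqn_leq nm andbT.
  (* The bound [z] is tested at [(t, n.+1)]: this point lies above [x] and differs from it, so only
     the disjunct placing [y] at or below it remains. *)
  pose s' := update s z (t, n.+1).
  have /= : supplement S z (fun=> setT) s' by exists s, (t, n.+1).
  rewrite eS eS0 => -[/nle | [/eq | /le']] /=; rewrite /s' update_eq ?update_neq//.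
  - by case; exists (t, n), (t, n.+1).
  - move=> [d' [e [[<-]]]]; rewrite sx => -[<-] [] /eqP.
    by rewrite gtn_eqF.
  - by move=> [d' [e [+ [<-]]]]; rewrite sy => -[<-] [].
split; [|split].
- move=> s /al[t [sx sy]]; exists (t, n), (t, n.+1); split=> //=.
- move=> s /al[t [sx sy]] [d [e []]]; rewrite sx sy => -[<-] [<-] [] /eqP.
  by rewrite ltn_eqF.
pose S' := supplement S z (fun=> setT).
exists [set s | S' s /\ ~ atom_sat (M := team_structure T) s (ALe x z)],
  [set s | S' s /\ atom_sat (M := team_structure T) s (ALe x z)].
split; [|by move=> s []|].
  by apply/seteqP; split=> s => [S's|[[]|[]]//]; have [?|?] := pselect
    (atom_sat (M := team_structure T) s (ALe x z)); [right|left].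
exists [set s | S' s /\ atom_sat (M := team_structure T) s (AEq z x)],
  [set s | S' s /\ atom_sat (M := team_structure T) s (ALe y z)].
split; [|by move=> s []|by move=> s []].
apply/seteqP; split=> [s|s [|]] [S's].
- move=> le.
  suff : atom_sat (M := team_structure T) s (AEq z x) \/
         atom_sat (M := team_structure T) s (ALe y z) by case; [left|right].
  case: S's le => {}s [[t' m] [Ss _ ->]] /=.
  have [t [sx sy]] := al s Ss.
  rewrite update_eq !update_neq// sx sy.
  move=> [d [e [[<-] [<-] [/= ?]]]]; subst t'.
  rewrite leq_eqVlt => /predU1P[<-|nm]; first by left; do 2 eexists.
  by right; do 2 eexists; split=> //=.
- move=> h; split=> //; case: S's h => {}s [[t' m] [Ss _ ->]] /=.
  have [t [sx sy]] := al s Ss.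
  rewrite update_eq !update_neq// sx.
  by move=> [d [e [[<-] [<-] <-]]]; do 2 eexists.
- move=> h; split=> //; case: S's h => {}s [[t' m] [Ss _ ->]] /=.
  have [t [sx sy]] := al s Ss.
  rewrite update_eq !update_neq// sx sy.
  by move=> [d [e [[<-] [<-] [/= -> /ltnW nm]]]]; do 2 eexists.
Qed.

(* A splitting of the trace team lifts to the assignments carrying it. *)
Lemma tail_team_split (AP : Type) (T : set (trace AP)) (V : eqType)
    (S : fo_team T V) (x : V) (n : nat) (T1 T2 : set (trace AP)) :
  at_level S x n -> tail_team S x = T1 `|` T2 ->
  exists S1 S2,
    [/\ S = S1 `|` S2, tail_team S1 x = T1 & tail_team S2 x = T2].
Proof.
move=> lS eT.
(* An assignment whose suffix lies in both [T1] and [T2] goes to both sides, which the lax semantics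
   allows. *)
pose part T' := [set s | S s /\ exists d,
  s x = Some d /\ T' (suffix_trace d.2 (sval d.1))].
have partP T' : T' `<=` tail_team S x -> tail_team (part T') x = T'.
  move=> sT; apply/seteqP; split=> u.
    by move=> [s [d [[Ss [e [+ Te]]] + ->]]] => -> [<-].
  move=> Tu; have [s [d [Ss sx ue]]] := sT u Tu; exists s, d; split=> //.
  by split=> //; exists d; rewrite -ue.
exists (part T1), (part T2); split.
- apply/seteqP; split=> [s Ss|s [[]|[]]//]; have [t sx] := lS s Ss.
  have : tail_team S x (suffix_trace n (sval t)) by exists s, (t, n).
  by rewrite eT => -[] ?; [left|right]; split=> //; exists (t, n).
- by apply: partP; rewrite eT; exact: subsetUl.
- by apply: partP; rewrite eT; exact: subsetUr.
Qed.

Lemma tail_teamU (AP : Type) (T : set (trace AP)) (V : eqType)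
    (S1 S2 : fo_team T V) (x : V) :
  tail_team (S1 `|` S2) x = tail_team S1 x `|` tail_team S2 x.
Proof.
apply/seteqP; split=> u.
  by move=> [s [d [[] Ss sx ->]]]; [left|right]; exists s, d.
by move=> [|] [s [d [Ss sx ->]]]; exists s, d; split=> //; [left|right].
Qed.

(** * Constant levels enforced by dependence atoms *)

(** Provides a constant choice function that satisfies a dependence atom. The trace of the point
    comes from an assignment in [S]; if [S] is empty, the structure may have no point at all, so
    non-emptiness of [A] is only conditional. *)
Lemma level_point (AP : Type) (T : set (trace AP)) (V : eqType)
    (S : fo_team T V) (x : V) (n m : nat) : at_level S x n ->
  exists A : set (dom (team_structure T)),
    [/\ S !=set0 -> A !=set0, forall a b, A a -> A b -> a = b
      & forall a, A a -> a.2 = m].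
Proof.
move=> lS; have [[s /lS[t _]]|S0] := pselect (S !=set0).
  exists [set (t, m)]; split=> [_|a b -> ->|a ->//] //.
  by exists (t, m).
by exists set0; split.
Qed.

(** A constant [x] has one level, which [z] shares; conversely any point of that level serves as
    [x]. In the clause for U this rebinding of [x] is confined to its own conjunct, so the outer [x]
    survives beside it. *)
Lemma constant_levelP (AP : Type) (T : set (trace AP)) (V : eqType)
    (S : fo_team T V) (x z : V) : z != x ->
  fo_sat (M := team_structure T) S
    (FEx x (FAnd (FDep [::] x) (FPos (ALvl z x)))) <->
  exists m, at_level S z m.
Proof.
move=> zx; split=> [[F [F0 [/= dep lvl]]]|[m lS]].
  have [[s0 Ss0]|S0] := pselect (S !=set0); last first.
    (* Every level is correct for the empty team; 0 is a default. *)
    by exists 0%N => s Ss; case: S0; exists s.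
  have [a0 Fa0] := F0 _ Ss0.
  exists a0.2 => s Ss; have [a Fa] := F0 _ Ss.
  have sup s' b : S s' -> F s' b -> supplement S x F (update s' x b).
    by exists s', b.
  have : update s x a x = update s0 x a0 x by apply: dep => //; exact: sup.
  rewrite !update_eq => -[?]; subst a0.
  have [[t m] [e []]] := lvl _ (sup _ _ Ss Fa).
  by rewrite update_neq// update_eq => sz [<-] /= <-; exists t.
have [A [A0 A1 Am]] := level_point m lS.
exists (fun=> A); split; [by move=> s Ss; apply: A0; exists s|split=> /=].
  move=> _ _ [s [a [_ Aa ->]]] [s' [a' [_ Aa' ->]]] _.
  by rewrite !update_eq (A1 a a').
move=> _ [s [a [Ss Aa ->]]]; have [t sz] := lS s Ss.
by exists (t, m), a; rewrite update_neq// update_eq /= (Am a).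
Qed.

(** * Correctness of the translation *)

(** The induction needs all variables, levels and teams at once: X and U permute the variables and
    raise the level, and a splitting passes to subteams. These may be empty, so the empty team is
    covered too. *)
Lemma ST_correct (AP : Type) (T : set (trace AP)) (V : eqType) (phi : ltl AP)
    (x y z : V) (n : nat) (S : fo_team T V) :
  uniq [:: x; y; z] -> at_level S x n ->
  fo_sat (M := team_structure T) S (ST x y z phi) <->
  team_sat (tail_team S x) phi.
Proof.
elim: phi x y z n S => [p|p|a IHa b IHb|a IHa b IHb|a IHa|a IHa|a IHa b IHb]
  x y z n S xyz lS.
- split=> [Sp u [s [d [Ss sx ->]]]|Tp s Ss] /=.
    by have [e] := Sp s Ss; rewrite sx => -[<-]; rewrite /suffix_trace addn0.
  have [t sx] := lS s Ss; exists (t, n) => //=.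
  have := Tp (suffix_trace n (sval t)); rewrite /suffix_trace addn0; apply.
  by exists s, (t, n).
- split=> [Sp u [s [d [Ss sx ->]]]|Tp s Ss] /=.
    move=> pd; apply: (Sp s Ss) => /=; exists d => //.
    by move: pd; rewrite /suffix_trace addn0.
  move=> [d sx pd]; apply: (Tp (suffix_trace d.2 (sval d.1))).
    by exists s, d.
  by rewrite /suffix_trace addn0.
- by rewrite /= (IHa x y z n S)// (IHb x y z n S).
- split=> [[S1 [S2 [eS Sa Sb]]]|[T1 [T2 [eT Ta Tb]]]].
    exists (tail_team S1 x), (tail_team S2 x); split.
    + by rewrite eS tail_teamU.
    + by apply/(IHa x y z n) => // s ?; apply: lS; rewrite eS; left.
    + by apply/(IHb x y z n) => // s ?; apply: lS; rewrite eS; right.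
  have [S1 [S2 [eS eT1 eT2]]] := tail_team_split lS eT.
  exists S1, S2; split=> //.
  + by apply/(IHa x y z n); rewrite ?eT1// => s ?; apply: lS; rewrite eS; left.
  + by apply/(IHb x y z n); rewrite ?eT2// => s ?; apply: lS; rewrite eS; right.
- by rewrite /= (IHa x y z n S).
- have [xy xz yz] : [/\ x != y, x != z & y != z].
    by move: xyz; rewrite /= !inE negb_or => /and3P[/andP[]].
  have yxz : uniq [:: y; x; z].
    by rewrite /= !inE negb_or eq_sym xy yz xz.
  split=> [[F [F0 [/(succ_fo_aligned xz yz (at_level_supplement xy lS)) al]]]|].
    move/(IHa y x z n.+1 _ yxz (aligned_levelr al)).
    rewrite -addn1 in al.
    by rewrite (aligned_tail_team al) tail_team_supplement.
  move=> /= Ta; have al := aligned_jump (m := n.+1) xy lS.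
  exists (jump x n.+1); split; first exact: jump_neq0 lS.
  split; first by apply/(succ_fo_aligned xz yz (at_level_supplement xy lS)).
  apply/(IHa y x z n.+1 _ yxz (aligned_levelr al)).
  rewrite -addn1 in al *.
  rewrite (aligned_tail_team al) tail_team_supplement//.
  exact: jump_neq0 lS.
- have [xy xz yz] : [/\ x != y, x != z & y != z].
    by move: xyz; rewrite /= !inE negb_or => /and3P[/andP[]].
  have yxz : uniq [:: y; x; z].
    by rewrite /= !inE negb_or eq_sym xy yz xz.
  have zyx : uniq [:: z; y; x].
    by rewrite /= !inE negb_or (eq_sym z y) (eq_sym z x) (eq_sym y x) yz xz xy.
  have zx : z != x by rewrite eq_sym.
  have zy : z != y by rewrite eq_sym.
  split.
    move=> [F [F0 [G [G0 [[depz [le_xy [lvl_zy STb]]] nSTa]]]]].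
    set S1 := supplement S z F in G0 depz le_xy lvl_zy STb nSTa.
    set S2 := supplement S1 y G in depz le_xy lvl_zy STb nSTa.
    have lS2 : at_level S2 x n by do 2 apply: at_level_supplement => //.
    have tS2 : tail_team S2 x = tail_team S x.
      by rewrite !tail_team_supplement.
    (* On an empty team [k] is taken to be 0, so that no earlier level has to satisfy [a]; the first
       conjunct records that a positive [k] comes with an actual assignment. *)
    have [k [k0 al]] : exists k,
        (k != 0%N -> S2 !=set0) /\ aligned S2 x y n (n + k).
      have [[s0 Ss0]|S20] := pselect (S2 !=set0); last first.
        by exists 0%N; split=> // s Ss; case: S20; exists s.
      have [d0 [e0 [z0 y0 /= de0]]] := lvl_zy _ Ss0.
      have [d1 [e1 [x1 y1 [_ le0]]]] := le_xy _ Ss0.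
      exists (d0.2 - n)%N; split=> [_|s Ss]; first by exists s0.
      have [t sx] := lS2 s Ss; exists t.
      have [t0 x0] := lS2 _ Ss0.
      move: x1 y1 le0; rewrite x0 y0 => -[<-] [<-] /=; rewrite -de0 => le0.
      rewrite subnKC//; split=> //.
      have [d [e [sz sy /= de]]] := lvl_zy _ Ss.
      (* The dependence atom carries the value of [z] over from [s0], and the equal-level atom
         passes its level on to [y], which stays on the trace of [x]. *)
      have [d2 [e2 [+ + [+ _]]]] := le_xy _ Ss; rewrite sx sy => -[<-] [<-] /= ->.
      have : s z = s0 z by exact: depz.
      by rewrite sz z0 => -[<-]; rewrite de -surjective_pairing.
    exists k; split.
      rewrite -tS2 -(aligned_tail_team al).
      by apply/(IHb y x z _ _ yxz (aligned_levelr al)).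
    (* If [a] failed at offset [k'], sending [z] to level [n + k'] on the trace of [x] would satisfy
       the formula under the Boolean negation. *)
    move=> k' k'k; apply: contrapT => nTa; apply: nSTa.
    (* Strictness of [z] below [y] is a Boolean negation, so it needs an assignment at which they
       differ; the positive [k] provides one. *)
    have [s0 S2s0] : S2 !=set0 by apply: k0; case: (k) k'k.
    pose H := jump (T := T) x (n + k').
    have H0 s : S2 s -> H s !=set0 by exact: jump_neq0 lS2 s.
    pose S3 := supplement S2 z H.
    have alx : aligned S3 x z n (n + k') by exact: aligned_jump.
    have aly : aligned S3 x y n (n + k).
      move=> _ [s [d [/al[t [sx sy]] _ ->]]]; exists t.
      by rewrite !update_neq.
    exists H; split=> //; split.
      apply: (proj2 (constant_levelP S3 zx)).
      by exists (n + k')%N; exact: aligned_levelr alx.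
    split; [split; [|split]|] => /=.
    - move=> s /alx[t [sx sz]]; exists (t, n), (t, n + k')%N.
      by split=> //=; rewrite leq_addr.
    - move=> s Ss; have [t [sx sz]] := alx s Ss; have [t' [sx' sy]] := aly s Ss.
      move: sx'; rewrite sx => -[?]; subst t'.
      exists (t, n + k')%N, (t, n + k)%N.
      by split=> //=; rewrite leq_add2l ltnW.
    - move=> eq; have [d Hd] := H0 _ S2s0.
      have S3s : S3 (update s0 z d) by exists s0, d.
      have [t [_ sz]] := alx _ S3s; have [t' [_ sy]] := aly _ S3s.
      have [e [e' []]] := eq _ S3s.
      rewrite sz sy => -[<-] [<-] [_] /eqP.
      by rewrite eqn_add2l ltn_eqF.
    - move/(IHa z y x _ _ zyx (aligned_levelr alx)).
      by rewrite (aligned_tail_team alx) tail_team_supplement// tS2.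
  move=> [k [Tb Ta]].
  (* For the converse, [z] is a single point that fixes the level [n + k] for the whole team, and
     [y] moves to that level on each trace separately. *)
  have [A [A0 A1 Am]] := level_point (n + k) lS.
  pose F : assignment V (dom (team_structure T)) -> set (dom (team_structure T)) :=
    fun=> A.
  have F0 s : S s -> F s !=set0 by move=> Ss; apply: A0; exists s.
  pose S1 := supplement S z F.
  have lS1 : at_level S1 x n by exact: at_level_supplement.
  pose G := jump (T := T) x (n + k).
  have G0 s : S1 s -> G s !=set0 by exact: jump_neq0 lS1 s.
  pose S2 := supplement S1 y G.
  have al : aligned S2 x y n (n + k) by exact: aligned_jump.
  have lS2 : at_level S2 x n by exact: at_level_supplement.
  have tS2 : tail_team S2 x = tail_team S x.
    by rewrite !tail_team_supplement.
  exists F; split=> //; exists G; split=> //; split; [split; [|split; [|split]]|].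
  - move=> _ s2 [_ [d [[s [c [_ Ac ->]]] _ ->]]].
    move=> [_ [d' [[s' [c' [_ Ac' ->]]] _ ->]]] _.
    by rewrite !(update_neq _ _ zy) !update_eq (A1 c c').
  - move=> s /al[t [sx sy]]; exists (t, n), (t, n + k)%N.
    by split=> //=; rewrite leq_addr.
  - move=> s S2s; have [t [_ sy]] := al s S2s.
    case: S2s sy => _ [d [[s' [c [_ Ac ->]]] _ ->]] sy.
    exists c, (t, n + k)%N; rewrite sy (update_neq _ _ zy) update_eq /=.
    by split=> //; exact: Am.
  - apply/(IHb y x z _ _ yxz (aligned_levelr al)).
    by rewrite (aligned_tail_team al) tS2.
  (* Whatever choice is made for [z], the conjuncts put it on the trace of [x] at one level [m] with
     [n <= m < n + k], where [a] holds by assumption. *)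
  - move=> [H [H0 [/(constant_levelP _ zx)[m lz] [[le_xz [le_zy ne_zy]] nSTa]]]].
    set S3 := supplement S2 z H in lz le_xz le_zy ne_zy nSTa.
    have lS3 : at_level S3 x n by exact: at_level_supplement.
    have tS3 : tail_team S3 x = tail_team S x by rewrite tail_team_supplement.
    have aly : aligned S3 x y n (n + k).
      move=> _ [s [d [/al[t [sx sy]] _ ->]]]; exists t.
      by rewrite !update_neq.
    have alz : aligned S3 x z n m.
      move=> s Ss; have [t sx] := lS3 s Ss; have [t' sz] := lz s Ss.
      have [d [e []]] := le_xz s Ss.
      by rewrite sx sz => -[<-] [<-] [/= <- _]; exists t.
    (* The Boolean negation yields just one assignment where [z] and [y] differ. As both have
       constant levels, it decides [m < n + k] for the whole team. *)
    have [s [S3s ne]] : exists s, S3 s /\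
        ~ atom_sat (M := team_structure T) s (AEq z y).
      apply: contrapT => h; apply: ne_zy => s S3s.
      by apply: contrapT => ne; apply: h; exists s.
    have [t [sx sz]] := alz s S3s.
    have [t' [sx' sy]] := aly s S3s.
    move: sx'; rewrite sx => -[?]; subst t'.
    have nm : (n <= m)%N.
      have [d [e []]] := le_xz s S3s.
      by rewrite sx sz => -[<-] [<-] [].
    have mk : (m < n + k)%N.
      have [d [e []]] := le_zy s S3s.
      rewrite sz sy => -[<-] [<-] [_ /= mk]; rewrite ltn_neqAle mk andbT.
      apply/eqP => ?; subst m; apply: ne.
      by exists (t, n + k)%N, (t, n + k)%N.
    apply: nSTa; apply/(IHa z y x _ _ zyx (aligned_levelr alz)).
    have alz' : aligned S3 x z n (n + (m - n)) by rewrite subnKC.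
    rewrite (aligned_tail_team alz') tS3; apply: Ta.
    by rewrite ltn_subLR.
Qed.

(** * The equivalent sentence *)

Definition first_fo (AP : Type) (V : eqType) (x y : V) : fo V AP :=
  FAll y (FOr (FNeg (ALe y x)) (FPos (AEq x y))).

Definition nonfirst_fo (AP : Type) (V : eqType) (x y : V) : fo V AP :=
  FEx y (FAnd (FPos (ALe y x)) (FNeg (AEq x y))).

Definition closed_ST (AP : Type) (V : eqType) (x y z : V) (phi : ltl AP) :
    fo V AP :=
  FAll x (FOr (nonfirst_fo AP x y) (FAnd (first_fo AP x y) (ST x y z phi))).

(** Testing a predicate on the free variables replaces the filtering at a quantifier by a weaker
    predicate, so closedness is proved by rewriting. *)
Lemma all_free_vars (AP : Type) (V : eqType) :
  (forall (P : pred V) (f g : fo V AP), all P (free_vars (FAnd f g)) =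
     all P (free_vars f) && all P (free_vars g)) *
  (forall (P : pred V) (f g : fo V AP), all P (free_vars (FOr f g)) =
     all P (free_vars f) && all P (free_vars g)) *
  (forall (P : pred V) (f : fo V AP), all P (free_vars (FBNeg f)) =
     all P (free_vars f)) *
  (forall (P : pred V) (x : V) (f : fo V AP), all P (free_vars (FEx x f)) =
     all [pred v | (v != x) ==> P v] (free_vars f)) *
  (forall (P : pred V) (x : V) (f : fo V AP), all P (free_vars (FAll x f)) =
     all [pred v | (v != x) ==> P v] (free_vars f)).
Proof. by do 4?split=> *; rewrite /= ?all_cat ?all_filter. Qed.

(** The induction is over all [P]: under a quantifier the weakened predicate holds at the bound
    variable, which is the free variable of the translated subformula. *)
Lemma free_vars_ST (AP : Type) (V : eqType) (x y z : V) (phi : ltl AP)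
    (P : pred V) : P x -> all P (free_vars (ST x y z phi)).
Proof.
elim: phi x y z P => [p|p|a IHa b IHb|a IHa b IHb|a IHa|a IHa|a IHa b IHb]
  x y z P Px; simpl ST;
  by rewrite /succ_fo /lt_fo ?all_free_vars ?IHa ?IHb /= ?eqxx ?Px ?implybT.
Qed.

Lemma sentence_closed_ST (AP : Type) (V : eqType) (x y z : V) (phi : ltl AP) :
  sentence (closed_ST x y z phi).
Proof.
(* Only the empty list passes [pred0]. *)
suff : all pred0 (free_vars (closed_ST x y z phi)) by rewrite /sentence; case: (free_vars _).
rewrite /closed_ST /nonfirst_fo /first_fo !all_free_vars free_vars_ST /=.
  by rewrite !eqxx !implybT.
by rewrite eqxx.
Qed.

(** Definedness of [x] is assumed because a negated atom is true at an assignment where its variable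
    has no value. *)
Lemma first_foP (AP : Type) (T : set (trace AP)) (V : eqType)
    (S : fo_team T V) (x y : V) : x != y -> (forall s, S s -> s x <> None) ->
  fo_sat (M := team_structure T) S (first_fo AP x y) <-> at_level S x 0.
Proof.
move=> xy Sx; split=> [[S1 [S2 [eS nle eq]]] s Ss|lS].
  case sx: (s x) => [[t n]|]; last by case: (Sx s Ss).
  (* The first position of the same trace is the test value: it is never above [x], so it must equal
     [x]. *)
  pose s' := update s y (t, 0%N).
  have /= : supplement S y (fun=> setT) s' by exists s, (t, 0%N).
  rewrite eS => -[/nle|/eq] [].
    by exists (t, 0%N), (t, n); rewrite /s' update_eq update_neq.
  by move=> d [e]; rewrite /s' update_eq update_neq// => -[sx' [<-] ed];
    exists t; rewrite -sx sx' ed.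
pose S' : fo_team T V := supplement S y (fun=> setT).
exists (S' `\` [set s | atom_sat (M := team_structure T) s (ALe y x)]),
  (S' `&` [set s | atom_sat (M := team_structure T) s (ALe y x)]).
split; [by rewrite setUC setUIDK|by move=> s []|].
move=> _ [[s [[t n] [Ss _ ->]]]] [d [e]]; have [t' sx] := lS s Ss.
rewrite update_eq update_neq// sx => -[[<-] [<-] [/= ?]]; subst t'.
rewrite leqn0 => /eqP ->; exists (t, 0%N), (t, 0%N).
by rewrite update_eq update_neq.
Qed.

Lemma nonfirst_foP (AP : Type) (T : set (trace AP)) (V : eqType)
    (S : fo_team T V) (x y : V) : x != y ->
  fo_sat (M := team_structure T) S (nonfirst_fo AP x y) <->
  forall s, S s -> exists t n, s x = Some (t, n.+1).
Proof.
move=> xy; split=> [[F [F0 [le ne]]] s Ss|Sn].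
  have [d Fd] := F0 s Ss.
  have S's : supplement S y F (update s y d) by exists s, d.
  have := ne _ S's; have [d' [[t [|n]] []]] := le _ S's; last first.
    by rewrite (update_neq _ _ xy) => _ ->; exists t, n.
  move=> sy sx [/= ed]; rewrite leqn0 => /eqP d0; case; exists (t, 0%N), d'.
  by split=> //; rewrite -ed -d0 -surjective_pairing.
exists (jump x 0); split.
  by move=> s /Sn[t [n sx]]; exists (t, 0%N), t, n.+1.
have al s : supplement S y (jump (T := T) x 0) s ->
    exists t n, s x = Some (t, n.+1) /\ s y = Some (t, 0%N).
  move=> [s' [d [/Sn[t [n sx]] + ->]]]; move=> [t' [n' [+ ->]]].
  rewrite sx => -[<- _]; exists t, n.
  by rewrite update_neq// update_eq.
split=> s /al[t [n [sx sy]]].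
  by exists (t, 0%N), (t, n.+1).
by move=> [d [e []]]; rewrite sx sy => -[<-] [<-].
Qed.

Lemma closed_ST_correct (AP : Type) (T : set (trace AP)) (V : eqType)
    (x y z : V) (phi : ltl AP) : x != y ->
  fo_true (team_structure T) (closed_ST x y z phi) <->
  fo_sat (M := team_structure T) (init_team T x) (ST x y z phi).
Proof.
move=> xy; pose S := supplement [set @no_assignment V (dom (team_structure T))]
  x (fun=> setT).
have Sx s : S s -> exists t n, s = update (@no_assignment V _) x (t, n).
  by move=> [_ [[t n] [-> _ ->]]]; exists t, n.
have SI s t n : s = update (@no_assignment V _) x (t, n) -> S s.
  by move=> ->; exists (@no_assignment V _), (t, n).
split=> [[S1 [S2 [eS /(nonfirst_foP _ xy) S1n [S2first S2ST]]]]|IST].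
  have S2S s : S2 s -> S s by move=> S2s; rewrite /S eS; right.
  suff <- : S2 = init_team T x by [].
  have l2 : at_level S2 x 0.
    apply/(first_foP xy) => // s /S2S /Sx[t [n ->]].
    by rewrite update_eq.
  apply/seteqP; split=> s.
    move=> S2s; have [t [n es]] := Sx s (S2S s S2s).
    have [t'] := l2 s S2s; rewrite es update_eq => -[_ ->].
    by exists t.
  (* An initial assignment cannot lie in [S1], where every level is a successor, so it lies in
     [S2]. *)
  move=> [t es]; have := SI s t 0%N es; rewrite /S eS => -[|//].
  by move/S1n => [t' [n]]; rewrite es update_eq.
exists (S `\` init_team T x), (init_team T x); split.
- rewrite setUC setDUK// => _ [t ->]; exact: SI.
- apply/(nonfirst_foP _ xy) => s [Ss nI]; have [t [[|n] es]] := Sx s Ss.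
    by case: nI; exists t.
  by exists t, n; rewrite es update_eq.
- split=> //; apply/(first_foP xy) => [_ [t ->]|_ [t ->]].
    by rewrite update_eq.
  by exists t; rewrite update_eq.
Qed.

Lemma ST_init_team (AP : Type) (T : set (trace AP)) (V : eqType)
    (x y z : V) (phi : ltl AP) : uniq [:: x; y; z] ->
  fo_sat (M := team_structure T) (init_team T x) (ST x y z phi) <->
  team_sat T phi.
Proof.
move=> xyz; have lI : at_level (init_team T x) x 0.
  by move=> _ [t ->]; exists t; rewrite update_eq.
rewrite (ST_correct _ xyz lI).
(* At level 0 the suffix of a trace is the trace itself. *)
suff -> : tail_team (init_team T x) x = T by [].
apply/seteqP; split=> u.
  by move=> [_ [d [[t ->] + ->]]]; rewrite update_eq => -[<-]; exact: (svalP t).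
move=> Tu; exists (update (@no_assignment V _) x (exist _ u Tu, 0%N)).
by exists (exist _ u Tu, 0%N); split; [exists (exist _ u Tu)|rewrite update_eq|].
Qed.

Theorem theorem2 (AP : Type) (phi : ltl AP) :
  (forall T : set (trace AP), T !=set0 ->
     (team_sat T phi <->
      fo_sat (M := team_structure T) (init_team T vx) (ST vx vy vz phi))) /\
  (exists psi : fo3 AP, sentence psi /\
     forall T : set (trace AP), T !=set0 ->
       (team_sat T phi <-> fo_true (team_structure T) psi)).
Proof.
split=> [T _|]; first by rewrite ST_init_team.
exists (closed_ST vx vy vz phi); split; first exact: sentence_closed_ST.
by move=> T _; rewrite closed_ST_correct// ST_init_team.
Qed.
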